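(* Let $(\alpha_1,\alpha_2,\alpha_3)\in\mathbb R^3$ with $\alpha_1^2+\alpha_2^2+\alpha_3^2=1$, $\beta\in\mathbb R$, $t\in\mathbb R$, and put $$m_1=\tfrac t2,\quad n_1=1\quad\text{if }(\alpha_2+\beta)^2=1-\alpha_2^2;$$ $$m_1=\frac{\sinh\frac{t\sqrt{1-\alpha_2^2-(\alpha_2+\beta)^2}}{2}}{\sqrt{1-\alpha_2^2-(\alpha_2+\beta)^2}},\quad n_1=\cosh\frac{t\sqrt{1-\alpha_2^2-(\alpha_2+\beta)^2}}{2}\quad\text{if }(\alpha_2+\beta)^2<1-\alpha_2^2;$$ $$m_1=\frac{\sin\frac{t\sqrt{(\alpha_2+\beta)^2+\alpha_2^2-1}}{2}}{\sqrt{(\alpha_2+\beta)^2+\alpha_2^2-1}},\quad n_1=\cos\frac{t\sqrt{(\alpha_2+\beta)^2+\alpha_2^2-1}}{2}\quad\text{if }(\alpha_2+\beta)^2>1-\alpha_2^2.$$ If $\alpha_2\ne\pm1$, then the geodesic $\tilde\gamma_1(t)=\tilde\gamma_1(\alpha_1,\alpha_2,\alpha_3,\beta;t)=(A,B,v)(t)$, $t\in\mathbb R$, of $(SU(1,1)\times\mathbb R,d_1)$ is given by $$A=\left(n_1\cos\tfrac{\beta t}{2}+(\alpha_2+\beta)m_1\sin\tfrac{\beta t}{2}\right)+\left(n_1\sin\tfrac{\beta t}{2}-(\alpha_2+\beta)m_1\cos\tfrac{\beta t}{2}\right)i,$$ $$B=m_1\sqrt{1-\alpha_2^2}\left[\cos\left(\tfrac{\beta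 t}{2}+\varphi_0\right)-\sin\left(\tfrac{\beta t}{2}+\varphi_0\right)i\right],\qquad v=\alpha_2t,$$ where $\cos\varphi_0=\frac{\alpha_1}{\sqrt{1-\alpha_2^2}}$, $\sin\varphi_0=-\frac{\alpha_3}{\sqrt{1-\alpha_2^2}}$. If $\alpha_2=\pm1$, then this geodesic $\tilde\gamma_1(t)=(A,B,v)(t)$, $t\in\mathbb R$, is given by $A=e^{-i(\alpha_2t/2)}$, $B\equiv0$, $v=\alpha_2t$.
   Context: $SU(1,1)\times\mathbb R$ is the group of matrices $(A,B,v):=\begin{pmatrix}A&B&0\\ \overline B&\overline A&0\\0&0&e^v\end{pmatrix}$ with $A,B\in\mathbb C$, $|A|^2-|B|^2=1$, $v\in\mathbb R$. Its Lie algebra has basis $E_1=\frac12(e_{12}+e_{21})$, $E_2=\frac i2(e_{12}-e_{21})$, $E_3=\frac i2(e_{11}-e_{22})$, $E_4=e_{33}$, where $e_{ij}$ (double indices) are the $3\times3$ matrix units. Put $e_1=E_1$, $e_2=E_4-E_3$, $e_3=E_2$, $e_4=-E_3$. $d_1$ is the left-invariant sub-Riemannian metric defined by the left-invariant distribution with value $\mathrm{span}(e_1,e_2,e_3)$ at the unit $\mathrm{Id}$ and the inner product with orthonormal basis $e_1,e_2,e_3$. The arclength-parametrized geodesics of $d_1$ starting at $\mathrm{Id}$ are the curves $\tilde\gamma_1(\alpha_1,\alpha_2,\alpha_3,\beta;t)=\exp(t(\alpha_1e_1+\alpha_2e_2+\alpha_3e_3+\beta e_4))\exp(-t\beta e_4)$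 with $\alpha_1^2+\alpha_2^2+\alpha_3^2=1$, $\beta\in\mathbb R$. *)

(* Defs.v *)
(* MathComp-Analysis. *)
From HB Require Import structures.
From mathcomp Require Import all_boot all_order all_algebra.
From mathcomp Require Import all_classical all_reals all_analysis.
From mathcomp Require Import complex.

Set Implicit Arguments.
Unset Strict Implicit.
Unset Printing Implicit Defensive.

Import Order.TTheory GRing.Theory Num.Theory.
Import numFieldNormedType.Exports.

Local Open Scope classical_set_scope.
Local Open Scope ring_scope.
Local Open Scope complex_scope.

(* The limit is taken in the topology induced by the norm of K on entries;
   for K = R[i] this is the usual topology of the complex matrices. *)
Definition expmx (K : numFieldType) (n : nat) (X : 'M[K]_n) : 'M[K]_n :=
  limn (series (fun k : nat => (k`!%:R)^-1 *: X ^+ k)).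

Definition sinh (R : realType) (x : R) : R := (expR x - expR (- x)) / 2.

Definition cosh (R : realType) (x : R) : R := (expR x + expR (- x)) / 2.

Definition expC (R : realType) (z : R[i]) : R[i] :=
  (expR (complex.Re z))%:C * (cos (complex.Im z) +i* sin (complex.Im z)).

Section SU11R.
Variable R : realType.

Definition su11R_mx (A B : R[i]) (v : R) : 'M[R[i]]_3 :=
  \matrix_(i < 3, j < 3)
    nth 0 (nth [::] [:: [:: A;    B;    0];
                        [:: B^*;  A^*;  0];
                        [:: 0;    0;    (expR v)%:C]] i) j.

(* M is the element (A, B, v) of SU(1,1) x R *)
Definition su11R_elt (M : 'M[R[i]]_3) (A B : R[i]) (v : R) : Prop :=
  `|A| ^+ 2 - `|B| ^+ 2 = 1 /\ M = su11R_mx A B v.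

(* The matrix units, with rows and columns numbered from 0. *)
Definition munit (i j : 'I_3) : 'M[R[i]]_3 := delta_mx i j.

Definition E1 : 'M[R[i]]_3 := (1 / 2) *: (munit 0 1 + munit 1 0).
Definition E2 : 'M[R[i]]_3 := ('i%C / 2) *: (munit 0 1 - munit 1 0).
Definition E3 : 'M[R[i]]_3 := ('i%C / 2) *: (munit 0 0 - munit 1 1).
Definition E4 : 'M[R[i]]_3 := munit 2 2.

Definition e1 : 'M[R[i]]_3 := E1.
Definition e2 : 'M[R[i]]_3 := E4 - E3.
Definition e3 : 'M[R[i]]_3 := E2.
Definition e4 : 'M[R[i]]_3 := - E3.

(* For a1 ^ 2 + a2 ^ 2 + a3 ^ 2 = 1, these are the arclength-parametrized
   geodesics from the unit of the left-invariant sub-Riemannian metric on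
   SU(1,1) x R with orthonormal frame e1, e2, e3 at the unit. *)
Definition geod1 (a1 a2 a3 b t : R) : 'M[R[i]]_3 :=
  expmx (t%:C *: (a1%:C *: e1 + a2%:C *: e2 + a3%:C *: e3 + b%:C *: e4))
  *m expmx (- (t * b)%:C *: e4).

Definition m1 (a2 b t : R) : R :=
  if (a2 + b) ^+ 2 == 1 - a2 ^+ 2 then t / 2
  else if (a2 + b) ^+ 2 < 1 - a2 ^+ 2 then
    sinh (t * Num.sqrt (1 - a2 ^+ 2 - (a2 + b) ^+ 2) / 2)
      / Num.sqrt (1 - a2 ^+ 2 - (a2 + b) ^+ 2)
  else
    sin (t * Num.sqrt ((a2 + b) ^+ 2 + a2 ^+ 2 - 1) / 2)
      / Num.sqrt ((a2 + b) ^+ 2 + a2 ^+ 2 - 1).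

Definition n1 (a2 b t : R) : R :=
  if (a2 + b) ^+ 2 == 1 - a2 ^+ 2 then 1
  else if (a2 + b) ^+ 2 < 1 - a2 ^+ 2 then
    cosh (t * Num.sqrt (1 - a2 ^+ 2 - (a2 + b) ^+ 2) / 2)
  else
    cos (t * Num.sqrt ((a2 + b) ^+ 2 + a2 ^+ 2 - 1) / 2).

End SU11R.

(* Main.v *)
Require Import Defs.
From HB Require Import structures.
From mathcomp Require Import all_boot all_order all_algebra.
From mathcomp Require Import all_classical all_reals all_analysis.
From mathcomp Require Import complex.
From mathcomp Require Import ring lra.

Set Implicit Arguments.
Unset Strict Implicit.
Unset Printing Implicit Defensive.

Import Order.TTheory GRing.Theory Num.Theory.
Import numFieldNormedType.Exports.

Local Open Scope ring_scope.
Local Open Scope complex_scope.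

(** The geodesic is a product of two exponentials, and both exponents are of
    the form M + x E4, where M lives in the upper left 2 x 2 block and is
    a traceless matrix there. By Cayley-Hamilton, M ^ 2 = q (1 - E4) for a real
    number q, while E4 is an idempotent annihilating M on both sides. The even
    powers of M + x E4 thus contribute only to 1 - E4 and E4, the odd ones only
    to M and E4, and the exponential series splits into three scalar series
    ([expmx_split]):

      exp (M + x E4) = C (1 - E4) + S M + e^x E4,

    where C = cosh (sqrt q) and S = sinh (sqrt q) / sqrt q are understood as
    entire functions of q. Working with their power series in q, rather than
    with a diagonalization of M, treats uniformly q > 0 (hyperbolic functions),
    q < 0 (trigonometric functions) and q = 0 (where M is nilpotent).

    For the first factor of the geodesic q is
    (t / 2) ^ 2 (a1 ^ 2 + a3 ^ 2 - (a2 + b) ^ 2), which for a unit vector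
    (a1, a2, a3) is (t / 2) ^ 2 (1 - a2 ^ 2 - (a2 + b) ^ 2): the three cases in
    the definition of m1 and n1 are the three signs of q, with C = n1 and
    (t / 2) S = m1 ([cvg_n1_m1]). For the second factor q = - (b t / 2) ^ 2, and
    the exponential is a rotation by the angle b t / 2. Multiplying the two
    gives [geod1E]. The angle phi0 is the polar form of a1 + i a3, and when
    a2 = 1 or a2 = - 1 this number vanishes, both factors are diagonal, and
    their angles add up to - a2 t / 2. *)

(** * The exponential of a matrix with a scalar square on a block *)

(** Taylor coefficients, including the power of q, of cosh (sqrt q) and
    sinh (sqrt q) / sqrt q. They are indexed by the exponent of sqrt q, hence
    the parity factor, so as to run in parallel with the exponential series. *)
Definition cosh_coeff (K : numFieldType) (q : K) (k : nat) : K :=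
  (~~ odd k)%:R * q ^+ k./2 / k`!%:R.

Definition sinhc_coeff (K : numFieldType) (q : K) (k : nat) : K :=
  (odd k)%:R * q ^+ k./2 / k`!%:R.

Local Open Scope classical_set_scope.

Section ExpmxSplit.
Variables (K : numFieldType) (n : nat).
Implicit Types (M Q : 'M[K]_n) (q x C S E : K).

Lemma exprmx_split M Q q x k :
  M *m M = q *: (1%:M - Q) -> M *m Q = 0 -> Q *m M = 0 -> Q *m Q = Q ->
  (M + x *: Q) ^+ k = ((~~ odd k)%:R * q ^+ k./2) *: (1%:M - Q)
    + ((odd k)%:R * q ^+ k./2) *: M + x ^+ k *: Q.
Proof.
move=> MM MQ QM QQ; elim: k => [|k IHk].
  by rewrite !expr0 /= !mul1r mul0r scale0r addr0 !scale1r subrK.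
rewrite exprSr IHk -[LHS]/(_ *m _).
rewrite !(mulmxDl, mulmxDr) -!(scalemxAl, scalemxAr) !mulmxBl !mul1mx.
rewrite MM MQ QM QQ !subrr !(scaler0, add0r, addr0, subr0) !scalerA.
rewrite /= uphalf_half exprSr [X in X + _ = _]addrC.
by case: (odd k);
  rewrite ?(mul0r, mul1r, scale0r, add0r, addr0, add1n, add0n, exprSr).
Qed.

(** The limits C, S and E are parameters because which closed form C and S
    have depends on the sign of q. *)
Lemma expmx_split M Q q x C S E :
  M *m M = q *: (1%:M - Q) -> M *m Q = 0 -> Q *m M = 0 -> Q *m Q = Q ->
  series (cosh_coeff q) @ \oo --> C ->
  series (sinhc_coeff q) @ \oo --> S ->
  series (fun k => x ^+ k / k`!%:R) @ \oo --> E ->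
  expmx (M + x *: Q) = C *: (1%:M - Q) + S *: M + E *: Q.
Proof.
move=> MM MQ QM QQ cC cS cE; rewrite /expmx.
rewrite (_ : series _ = fun N => series (cosh_coeff q) N *: (1%:M - Q)
    + series (sinhc_coeff q) N *: M
    + series (fun k => x ^+ k / k`!%:R) N *: Q); last first.
  apply/funext => N; rewrite /series /= !scaler_suml -!big_split /=.
  apply: eq_bigr => k _; rewrite (exprmx_split x k MM MQ QM QQ).
  by rewrite !scalerDr !scalerA /cosh_coeff /sinhc_coeff ![_^-1 * _]mulrC.
apply: cvg_lim; first exact: norm_hausdorff.
by apply: cvgD; [apply: cvgD|]; apply: cvgZr_tmp.
Qed.

End ExpmxSplit.

(** * Closed forms of the two series *)

Section HyperbolicSeries.
Variable R : realType.
Implicit Types (x q l : R) (u : nat -> R).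

Lemma cvg_series_expR x : series (exp_coeff x) @ \oo --> expR x.
Proof. exact: is_cvg_series_exp_coeff. Qed.

Lemma expr_sqr_half_even x k : ~~ odd k -> (x ^+ 2) ^+ k./2 = x ^+ k.
Proof. by move=> /even_halfK kE; rewrite -exprM mul2n kE. Qed.

Lemma expr_sqr_half_odd x k : odd k -> x * (x ^+ 2) ^+ k./2 = x ^+ k.
Proof.
by move=> ok; rewrite -exprM mul2n -exprS odd_halfK // prednK // odd_gt0.
Qed.

Lemma cvg_cosh_coeff_sqr x : series (cosh_coeff (x ^+ 2)) @ \oo --> cosh x.
Proof.
rewrite (_ : series _ = fun n =>
    (series (exp_coeff x) n + series (exp_coeff (- x)) n) / 2).
  by apply: cvgMr_tmp; apply: cvgD; exact: cvg_series_expR.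
apply/funext => n; rewrite /series /= -big_split mulr_suml.
apply: eq_bigr => k _; rewrite /cosh_coeff /exp_coeff /= exprNn -signr_odd.
have k0 : k`!%:R != 0 :> R by rewrite pnatr_eq0 -lt0n fact_gt0.
case: (boolP (odd k)) => ok /=; first by rewrite expr1; field.
by rewrite expr_sqr_half_even // expr0; field.
Qed.

Lemma cvg_cosh_coeff_Nsqr x : series (cosh_coeff (- x ^+ 2)) @ \oo --> cos x.
Proof.
rewrite (_ : cosh_coeff _ = cos_coeff x).
  by rewrite cos.unlock; exact: is_cvg_series_cos_coeff.
apply/funext => k; rewrite /cosh_coeff cos_coeffE [(- _ ^+ 2) ^+ _]exprNn.
case: (boolP (odd k)) => ok /=; first by rewrite !mul0r.
rewrite expr_sqr_half_even //; field.
by rewrite pnatr_eq0 -lt0n fact_gt0.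
Qed.

Lemma cvg_cosh_coeff0 : series (cosh_coeff (0 : R)) @ \oo --> (1 : R).
Proof.
have := @cvg_cosh_coeff_sqr 0.
by rewrite expr0n /cosh oppr0 expR0 -mulr2n divff ?pnatr_eq0.
Qed.

Lemma cvg_sinhc_coeff0 : series (sinhc_coeff (0 : R)) @ \oo --> (1 : R).
Proof.
have E k : sinhc_coeff (0 : R) k = (k == 1)%:R.
  rewrite /sinhc_coeff; case: k => [|[|k]] /=; rewrite ?mul0r //.
    by rewrite expr0 !mulr1 divr1.
  by rewrite expr0n /= mulr0 mul0r.
apply: cvg_near_cst; exists 2 => // n /= n2.
rewrite /series /= (big_cat_nat _ n2) //= big_nat_recr //= big_nat1 !E add0r.
rewrite big_nat_cond big1 ?addr0 // => k /andP[/andP[k2 _] _].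
by rewrite E gtn_eqF.
Qed.

(** The known series are those of sinh and sin, that is, of x S rather than S.
    Stating the limit S through x S = l absorbs the removable singularity at
    x = 0, where S is 1 and not l / x. *)
Lemma cvg_sinhc_coeff q x u l :
    (forall k, x * sinhc_coeff q k = u k) -> (x = 0 -> q = 0) ->
  series u @ \oo --> l ->
  exists2 S, series (sinhc_coeff q) @ \oo --> S & x * S = l.
Proof.
move=> qu q0 ul; have [x0|x0] := eqVneq x 0.
  exists 1; first by rewrite q0 //; exact: cvg_sinhc_coeff0.
  rewrite x0 mul0r; apply: (cvg_unique _ _ ul); first exact: norm_hausdorff.
  rewrite (_ : series u = fun=> 0); first exact: cvg_cst.
  by apply/funext => n; rewrite /series /= big1 // => k _; rewrite -qu x0 mul0r.
exists (x^-1 * l); last by rewrite mulVKf.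
rewrite (_ : series _ = fun n => x^-1 * series u n).
  by apply: cvgMl_tmp.
apply/funext => n; rewrite /series /= mulr_sumr.
by apply: eq_bigr => k _; rewrite -qu mulKf.
Qed.

Lemma cvg_sinhc_coeff_sqr x :
  exists2 S, series (sinhc_coeff (x ^+ 2)) @ \oo --> S & x * S = sinh x.
Proof.
apply: (@cvg_sinhc_coeff _ _
          (fun k => (exp_coeff x k - exp_coeff (- x) k) / 2)).
- move=> k; rewrite /sinhc_coeff /exp_coeff /= exprNn -signr_odd.
  have k0 : k`!%:R != 0 :> R by rewrite pnatr_eq0 -lt0n fact_gt0.
  case: (boolP (odd k)) => ok /=; last by rewrite expr0; field.
  by rewrite mul1r mulrA expr_sqr_half_odd // expr1; field.
- by move=> ->; rewrite expr0n.
rewrite (_ : series _ = fun n =>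
    (series (exp_coeff x) n - series (exp_coeff (- x)) n) / 2).
  by apply: cvgMr_tmp; apply: cvgB; exact: cvg_series_expR.
by apply/funext => n; rewrite /series /= -sumrB mulr_suml.
Qed.

Lemma cvg_sinhc_coeff_Nsqr x :
  exists2 S, series (sinhc_coeff (- x ^+ 2)) @ \oo --> S & x * S = sin x.
Proof.
apply: (@cvg_sinhc_coeff _ _ (sin_coeff x)).
- move=> k; rewrite /sinhc_coeff sin_coeffE /= [(- _ ^+ 2) ^+ _]exprNn.
  case: (boolP (odd k)) => ok /=; last by rewrite !mul0r mulr0.
  rewrite -(expr_sqr_half_odd x ok) (_ : k.-1./2 = k./2).
    by field; rewrite pnatr_eq0 -lt0n fact_gt0.
  by case: k ok => //= k; rewrite uphalf_half; case: odd.
- by move=> ->; rewrite expr0n oppr0.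
by rewrite sin.unlock; exact: is_cvg_series_sin_coeff.
Qed.

End HyperbolicSeries.

(** * Real parameters in complex matrices *)

Section ExpmxComplex.
Variable R : realType.
(* The topology is attached to R[i] through its structure of numerical field. *)
Local Notation C := (R[i] : numFieldType).

Lemma cvg_series_complex (u : nat -> R) (l : R) :
  series u @ \oo --> l ->
  series (fun k => (u k)%:C : C) @ \oo --> (l%:C : C).
Proof.
move=> /cvgrPdist_lt ul; apply/cvgrPdist_lt => e e0.
(* A positive complex number is real. *)
case: e e0 => er ei; rewrite ltcE /= => /andP[/eqP -> er0].
near=> n.
have -> : series (fun k => (u k)%:C) n = (series u n)%:C.
  by rewrite /series /= rmorph_sum.
rewrite -rmorphB normc_def /= expr0n addr0 sqrtr_sqr ltcR.
near: n; exact: ul.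
Unshelve. all: by end_near.
Qed.

Lemma cosh_coeff_complex (q : R) :
  cosh_coeff (q%:C : C) = fun k => (cosh_coeff q k)%:C.
Proof.
apply/funext => k.
by rewrite /cosh_coeff [RHS]fmorph_div rmorphM rmorphXn !rmorph_nat.
Qed.

Lemma sinhc_coeff_complex (q : R) :
  sinhc_coeff (q%:C : C) = fun k => (sinhc_coeff q k)%:C.
Proof.
apply/funext => k.
by rewrite /sinhc_coeff [RHS]fmorph_div rmorphM rmorphXn !rmorph_nat.
Qed.

Lemma exp_coeff_complex (q : R) :
  (fun k => q%:C ^+ k / k`!%:R) = fun k => (exp_coeff q k)%:C.
Proof.
apply/funext => k.
by rewrite /exp_coeff [RHS]fmorph_div rmorphXn !rmorph_nat.
Qed.

Lemma expmx_split_complex n (M Q : 'M[R[i]]_n) (q x c s : R) :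
  M *m M = q%:C *: (1%:M - Q) -> M *m Q = 0 -> Q *m M = 0 -> Q *m Q = Q ->
  series (cosh_coeff q) @ \oo --> c ->
  series (sinhc_coeff q) @ \oo --> s ->
  expmx (M + x%:C *: Q) = c%:C *: (1%:M - Q) + s%:C *: M + (expR x)%:C *: Q.
Proof.
move=> MM MQ QM QQ /cvg_series_complex cC /cvg_series_complex cS.
have /cvg_series_complex cE := @cvg_series_expR _ x.
rewrite -cosh_coeff_complex in cC.
rewrite -sinhc_coeff_complex in cS.
rewrite -exp_coeff_complex in cE.
exact: (@expmx_split C n M Q q%:C x%:C c%:C s%:C (expR x)%:C
          MM MQ QM QQ cC cS cE).
Qed.

Lemma sqr_normc (z : R[i]) :
  `|z| ^+ 2 = (complex.Re z ^+ 2 + complex.Im z ^+ 2)%:C.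
Proof.
case: z => x y; rewrite normc_def -rmorphXn sqr_sqrtr //.
by rewrite addr_ge0 ?sqr_ge0.
Qed.

End ExpmxComplex.

(** * One-parameter subgroups and geodesics *)

Ltac complex_ring :=
  apply/eqP; rewrite eq_complex /=; apply/andP; split; apply/eqP; ring.

Ltac entrywise :=
  apply/matrixP => -[[|[|[|//]]] ?] [[|[|[|//]]] ?];
  rewrite ?(mxE, big_ord_recl, big_ord0) /= ?expRD; simpc; complex_ring.

Section SU11Matrices.
Variable R : realType.
Implicit Types (c x y v C S : R) (A B : R[i]).

(** The Lie algebra su(1,1), as the upper left block. *)
Definition su11_alg_mx c x y : 'M[R[i]]_3 :=
  \matrix_(i < 3, j < 3)
    nth 0 (nth [::] [:: [:: 0 -i* c;  x +i* y;  0];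
                        [:: x -i* y;  0 +i* c;  0];
                        [:: 0;        0;        0]] i) j.

Lemma half_complex : (2 : R[i])^-1 = (2^-1 : R)%:C.
Proof. by rewrite fmorphV rmorph_nat. Qed.

Lemma e1E : e1 R = su11_alg_mx 0 2^-1 0.
Proof. by rewrite /e1 /E1 /munit div1r half_complex; entrywise. Qed.

Lemma e3E : e3 R = su11_alg_mx 0 0 2^-1.
Proof. by rewrite /e3 /E2 /munit half_complex; entrywise. Qed.

Lemma e4E : e4 R = su11_alg_mx 2^-1 0 0.
Proof. by rewrite /e4 /E3 /munit half_complex; entrywise. Qed.

Lemma e2E : e2 R = su11_alg_mx 2^-1 0 0 + E4 R.
Proof. by rewrite -e4E /e2 /e4 addrC. Qed.

Lemma su11_alg_mxD c x y c' x' y' :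
  su11_alg_mx c x y + su11_alg_mx c' x' y'
  = su11_alg_mx (c + c') (x + x') (y + y').
Proof. by entrywise. Qed.

Lemma su11_alg_mxZ v c x y :
  v%:C *: su11_alg_mx c x y = su11_alg_mx (v * c) (v * x) (v * y).
Proof. by entrywise. Qed.

(** Cayley-Hamilton for a traceless 2 x 2 block: the scalar is the opposite of
    its determinant. *)
Lemma su11_alg_mx_sqr c x y :
  su11_alg_mx c x y *m su11_alg_mx c x y
  = (x ^+ 2 + y ^+ 2 - c ^+ 2)%:C *: (1%:M - E4 R).
Proof. by entrywise. Qed.

Lemma su11_alg_mxE4 c x y : su11_alg_mx c x y *m E4 R = 0.
Proof. by entrywise. Qed.

Lemma mulE4_su11_alg_mx c x y : E4 R *m su11_alg_mx c x y = 0.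
Proof. by entrywise. Qed.

Lemma E4_idem : E4 R *m E4 R = E4 R.
Proof. exact: mul_delta_mx. Qed.

Lemma expmx_su11_alg_mx c x y v C S :
  series (cosh_coeff (x ^+ 2 + y ^+ 2 - c ^+ 2)) @ \oo --> C ->
  series (sinhc_coeff (x ^+ 2 + y ^+ 2 - c ^+ 2)) @ \oo --> S ->
  expmx (su11_alg_mx c x y + v%:C *: E4 R)
  = su11R_mx (C -i* (c * S)) ((x * S) +i* (y * S)) v.
Proof.
move=> cC cS.
rewrite (expmx_split_complex v (su11_alg_mx_sqr c x y) _ _ _ cC cS).
- by entrywise.
- exact: su11_alg_mxE4.
- exact: mulE4_su11_alg_mx.
- exact: E4_idem.
Qed.

Lemma mul_su11R_mx A B v A' B' v' :
  su11R_mx A B v *m su11R_mx A' B' v'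
  = su11R_mx (A * A' + B * B'^*) (A * B' + B * A'^*) (v + v').
Proof.
by move: A B A' B' => [p q] [r s] [p' q'] [r' s']; entrywise.
Qed.

(** The scalar q is the one that [su11_alg_mx_sqr] gives for the first
    exponent. In the second exponent the block is diagonal, with
    q = - (b t / 2) ^ 2. *)
Lemma geod1E (a1 a2 a3 b t C S : R)
    (q := (t / 2) ^+ 2 * (a1 ^+ 2 + a3 ^+ 2 - (a2 + b) ^+ 2))
    (m := t / 2 * S) :
  series (cosh_coeff q) @ \oo --> C ->
  series (sinhc_coeff q) @ \oo --> S ->
  geod1 a1 a2 a3 b t = su11R_mx
    ((C * cos (b * t / 2) + (a2 + b) * m * sin (b * t / 2))
     +i* (C * sin (b * t / 2) - (a2 + b) * m * cos (b * t / 2)))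
    (m%:C * (a1 +i* a3) * (cos (b * t / 2) -i* sin (b * t / 2)))
    (a2 * t).
Proof.
have qE : q = (t / 2 * a1) ^+ 2 + (t / 2 * a3) ^+ 2 - (t / 2 * (a2 + b)) ^+ 2
  by rewrite /q; ring.
rewrite qE => cC cS.
have X1 :
    t%:C *: (a1%:C *: e1 R + a2%:C *: e2 R + a3%:C *: e3 R + b%:C *: e4 R)
    = su11_alg_mx (t / 2 * (a2 + b)) (t / 2 * a1) (t / 2 * a3)
      + (a2 * t)%:C *: E4 R.
  rewrite e2E e4E e1E e3E !scalerDr !su11_alg_mxZ scalerA -rmorphM !addrA.
  rewrite ![_ + _ *: E4 R + _]addrAC !su11_alg_mxD [t * a2]mulrC.
  by congr (su11_alg_mx _ _ _ + _); field.
have X2 : - (t * b)%:C *: e4 R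
    = su11_alg_mx (- (b * t / 2)) 0 0 + 0%:C *: E4 R.
  rewrite e4E -rmorphN su11_alg_mxZ scale0r addr0.
  by congr su11_alg_mx; field.
have [S' cS' bS'] := @cvg_sinhc_coeff_Nsqr _ (b * t / 2).
have cC' := @cvg_cosh_coeff_Nsqr _ (b * t / 2).
rewrite /geod1 X1 X2 (expmx_su11_alg_mx _ cC cS).
have q'E : - (b * t / 2) ^+ 2 = 0 ^+ 2 + 0 ^+ 2 - (- (b * t / 2)) ^+ 2 by ring.
rewrite q'E in cC' cS'.
rewrite (expmx_su11_alg_mx _ cC' cS') mul_su11R_mx -bS' addr0.
by congr su11R_mx; rewrite /m; complex_ring.
Qed.

(** Since |A| ^ 2 - |B| ^ 2 is the determinant of the upper left block, which
    the rotation in the second factor preserves, membership in SU(1,1) amounts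
    to cosh ^ 2 - sinh ^ 2 = 1 for C and S. *)
Lemma geod1_elt (a1 a2 a3 b t C S : R)
    (w := a1 ^+ 2 + a3 ^+ 2 - (a2 + b) ^+ 2) (m := t / 2 * S) :
  series (cosh_coeff ((t / 2) ^+ 2 * w)) @ \oo --> C ->
  series (sinhc_coeff ((t / 2) ^+ 2 * w)) @ \oo --> S ->
  C ^+ 2 - w * m ^+ 2 = 1 ->
  su11R_elt (geod1 a1 a2 a3 b t)
    ((C * cos (b * t / 2) + (a2 + b) * m * sin (b * t / 2))
     +i* (C * sin (b * t / 2) - (a2 + b) * m * cos (b * t / 2)))
    (m%:C * (a1 +i* a3) * (cos (b * t / 2) -i* sin (b * t / 2)))
    (a2 * t).
Proof.
move=> cC cS Cm; split; last exact: geod1E.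
rewrite !sqr_normc -rmorphB; congr (_%:C) => /=.
transitivity ((C ^+ 2 - w * m ^+ 2)
    * (cos (b * t / 2) ^+ 2 + sin (b * t / 2) ^+ 2)); first by rewrite /w; ring.
by rewrite Cm cos2Dsin2 mulr1.
Qed.

End SU11Matrices.

(** * The three regimes of m1 and n1 *)

Section Coefficients.
Variable R : realType.

Lemma n1_m1_sqr (a2 b t : R) :
  n1 a2 b t ^+ 2 - (1 - a2 ^+ 2 - (a2 + b) ^+ 2) * m1 a2 b t ^+ 2 = 1.
Proof.
rewrite /n1 /m1; case: eqVneq => [->|ne]; first by ring.
case: ltP => [lt|le].
- set w := 1 - a2 ^+ 2 - (a2 + b) ^+ 2.
  have w0 : 0 < w by rewrite subr_gt0.
  rewrite [(_ / Num.sqrt _) ^+ 2]expr_div_n (sqr_sqrtr (ltW w0)).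
  rewrite mulrCA divff ?gt_eqF // mulr1.
  set x := t * _ / 2; rewrite /cosh /sinh.
  have := expRxMexpNx_1 x.
  set u := expR x; set v := expR (- x) => uv.
  by rewrite -[RHS]uv; field.
- rewrite (_ : 1 - a2 ^+ 2 - (a2 + b) ^+ 2
    = - ((a2 + b) ^+ 2 + a2 ^+ 2 - 1)); last by ring.
  set w := _ + _ - 1.
  have w0 : 0 < w.
    by rewrite /w; move: le ne; rewrite le_eqVlt eq_sym => /orP[->//|]; lra.
  rewrite [(_ / Num.sqrt _) ^+ 2]expr_div_n (sqr_sqrtr (ltW w0)).
  rewrite mulNr opprK mulrCA divff ?gt_eqF // mulr1.
  exact: cos2Dsin2.
Qed.

Lemma cvg_n1_m1 (a2 b t : R)
    (q := (t / 2) ^+ 2 * (1 - a2 ^+ 2 - (a2 + b) ^+ 2)) :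
  series (cosh_coeff q) @ \oo --> n1 a2 b t /\
  exists2 S, series (sinhc_coeff q) @ \oo --> S & t / 2 * S = m1 a2 b t.
Proof.
rewrite /q /n1 /m1; case: eqVneq => [->|ne].
  rewrite subrr mulr0; split; first exact: cvg_cosh_coeff0.
  by exists 1; [exact: cvg_sinhc_coeff0 | rewrite mulr1].
case: ltP => [lt|le].
- set w := 1 - a2 ^+ 2 - (a2 + b) ^+ 2.
  have w0 : 0 < w by rewrite subr_gt0.
  have s0 : Num.sqrt w != 0 by rewrite gt_eqF // sqrtr_gt0.
  have -> : (t / 2) ^+ 2 * w = (t * Num.sqrt w / 2) ^+ 2.
    by rewrite -{1}(sqr_sqrtr (ltW w0)); field.
  split; first exact: cvg_cosh_coeff_sqr.
  have [S cS <-] := cvg_sinhc_coeff_sqr (t * Num.sqrt w / 2).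
  by exists S => //; field.
- rewrite (_ : 1 - a2 ^+ 2 - (a2 + b) ^+ 2
    = - ((a2 + b) ^+ 2 + a2 ^+ 2 - 1)); last by ring.
  set w := _ + _ - 1.
  have w0 : 0 < w.
    by rewrite /w; move: le ne; rewrite le_eqVlt eq_sym => /orP[->//|]; lra.
  have s0 : Num.sqrt w != 0 by rewrite gt_eqF // sqrtr_gt0.
  have -> : (t / 2) ^+ 2 * - w = - (t * Num.sqrt w / 2) ^+ 2.
    by rewrite -{1}(sqr_sqrtr (ltW w0)); field.
  split; first exact: cvg_cosh_coeff_Nsqr.
  have [S cS <-] := cvg_sinhc_coeff_Nsqr (t * Num.sqrt w / 2).
  by exists S => //; field.
Qed.

End Coefficients.

(** * The geodesics of SU(1,1) x R *)

Theorem theorem4 (R : realType) (a1 a2 a3 b : R) :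
  a1 ^+ 2 + a2 ^+ 2 + a3 ^+ 2 = 1 ->
  (a2 <> 1 /\ a2 <> - 1 ->
   forall phi0 : R,
     cos phi0 = a1 / Num.sqrt (1 - a2 ^+ 2) ->
     sin phi0 = - (a3 / Num.sqrt (1 - a2 ^+ 2)) ->
   forall t : R,
     su11R_elt (geod1 a1 a2 a3 b t)
       ((n1 a2 b t * cos (b * t / 2) + (a2 + b) * m1 a2 b t * sin (b * t / 2))
        +i* (n1 a2 b t * sin (b * t / 2)
             - (a2 + b) * m1 a2 b t * cos (b * t / 2)))
       ((m1 a2 b t * Num.sqrt (1 - a2 ^+ 2))%:C
        * (cos (b * t / 2 + phi0) -i* sin (b * t / 2 + phi0)))
       (a2 * t))
  /\
  (a2 = 1 \/ a2 = - 1 ->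
   forall t : R,
     su11R_elt (geod1 a1 a2 a3 b t)
       (expC (- ('i%C * (a2 * t / 2)%:C))) 0 (a2 * t)).
Proof.
move=> a123.
have a13 : a1 ^+ 2 + a3 ^+ 2 = 1 - a2 ^+ 2 by rewrite -a123; ring.
split=> [[a2N1 a2NN1] phi0 cosphi0 sinphi0 t|a2_1 t].
  have s0 : Num.sqrt (1 - a2 ^+ 2) != 0.
    rewrite sqrtr_eq0 -ltNge lt_def -{2}a13 addr_ge0 ?sqr_ge0 // andbT.
    rewrite subr_eq0 eq_sym sqrf_eq1 negb_or.
    by apply/andP; split; apply/eqP.
  have [cC [S cS Sm]] := cvg_n1_m1 a2 b t.
  rewrite -a13 in cC cS.
  have := geod1_elt cC cS; rewrite Sm a13 n1_m1_sqr => /(_ erefl).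
  suff -> : (m1 a2 b t)%:C * (a1 +i* a3) * (cos (b * t / 2) -i* sin (b * t / 2))
    = (m1 a2 b t * Num.sqrt (1 - a2 ^+ 2))%:C
        * (cos (b * t / 2 + phi0) -i* sin (b * t / 2 + phi0)) by [].
  rewrite cosD sinD cosphi0 sinphi0.
  by apply/eqP; rewrite eq_complex /=; apply/andP; split; apply/eqP; field.
have a2E : a2 ^+ 2 = 1 by case: a2_1 => ->; rewrite ?sqrrN expr1n.
have [a1E a3E] : a1 = 0 /\ a3 = 0.
  move/eqP: a13; rewrite a2E subrr paddr_eq0 ?sqr_ge0 // !sqrf_eq0.
  by move=> /andP[/eqP -> /eqP ->].
set c := a2 + b.
(* With a1 = a3 = 0, q is minus a square, so that cos and sin cover all signs
   of c, including c = 0. *)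
have wE : (t / 2) ^+ 2 * (a1 ^+ 2 + a3 ^+ 2 - c ^+ 2) = - (t / 2 * c) ^+ 2.
  by rewrite a1E a3E; ring.
have [S cS Ssin] := cvg_sinhc_coeff_Nsqr (t / 2 * c).
have cC := @cvg_cosh_coeff_Nsqr _ (t / 2 * c).
rewrite -wE in cC cS.
have := geod1_elt cC cS.
have cm : c * (t / 2 * S) = sin (t / 2 * c) by rewrite -Ssin; ring.
rewrite -/c cm (_ : _ - _ = 1); last first.
  by rewrite -[RHS](cos2Dsin2 (t / 2 * c)) -cm a1E a3E; ring.
have -> : a1 +i* a3 = 0 by rewrite a1E a3E.
rewrite mulr0 mul0r => /(_ erefl).
have angle : a2 * t / 2 = t / 2 * c - b * t / 2 by rewrite /c; field.
rewrite /expC /= angle; simpc.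
congr (su11R_elt _ _ _ _).
by rewrite cosB sinB expR0; congr (_ +i* _); ring.
Qed.
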